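(* Let $n\in\mathbb N$, let $q\ge2$ be a prime power, and let $G$ be the symplectic polar graph $\mathrm{Sp}(2n,q)$. Then 1. $\alpha(\overline{G})=\Theta(\overline{G})=\vartheta(\overline{G})=\frac{q^n-1}{q-1}$; 2. $\vartheta(G)=\chi_f(\overline{G})=\chi(\overline{G})=q^n+1$.
   Context: $\mathrm{Sp}(2n,q)$ is the graph whose vertices are the one-dimensional subspaces of $\mathbb F_q^{2n}$, two distinct such subspaces $\langle x\rangle,\langle y\rangle$ being adjacent iff $\omega(x,y)=0$ for a fixed nondegenerate alternating (symplectic) bilinear form $\omega$ on $\mathbb F_q^{2n}$. $\overline{G}$ is the complement; $\alpha$ the independence number; $\chi$ the chromatic number; $\chi_f$ the fractional chromatic number (minimum of $\sum_I x_I$ over nonnegative weights $x_I$ on independent sets $I$ with $\sum_{I\ni v}x_I\ge1$ for every vertex $v$); $\Theta(G)=\sup_k\alpha(G^{\boxtimes k})^{1/k}$ the Shannon capacity with respect to the strong product; $\vartheta(G)$ the Lovász theta function, i.e. the maximum of $\mathrm{Tr}(BJ)$ over positive semidefinite $B$ indexed by $V(G)$ with $\mathrm{Tr}B=1$ and $B_{i,j}=0$ for $\{i,j\}\in E(G)$, $J$ all-ones. *)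

(* Defs.v *)
From HB Require Import structures.
From mathcomp Require Import all_boot all_order all_algebra.
From mathcomp Require Import all_classical all_reals all_analysis.
Set Implicit Arguments. Unset Strict Implicit. Unset Printing Implicit Defensive.
Import Order.TTheory GRing.Theory Num.Theory.

Local Open Scope ring_scope.

Definition g_compl (T : finType) (E : rel T) : rel T :=
  fun x y => (x != y) && ~~ E x y.

Definition g_indep (T : finType) (E : rel T) (S : {set T}) : bool :=
  [forall x in S, forall y in S, ~~ E x y].

Definition g_alpha (T : finType) (E : rel T) : nat :=
  (\max_(S : {set T} | g_indep E S) #|S|)%N.

Definition strong_pow (T : finType) (E : rel T) (k : nat) : rel {ffun 'I_k -> T} :=
  fun x y => (x != y) && [forall i, (x i == y i) || E (x i) (y i)].

Arguments strong_pow {T} E k.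

Definition g_Theta (R : realType) (T : finType) (E : rel T) : R :=
  sup [set r : R | exists2 k : nat, (0 < k)%N &
                      r = ((g_alpha (@strong_pow T E k))%:R : R) `^ (k%:R^-1)].

Definition g_colorable (T : finType) (E : rel T) (k : nat) : bool :=
  [exists f : {ffun T -> 'I_k}, forall x, forall y, E x y ==> (f x != f y)].

Definition g_chi (T : finType) (E : rel T) : nat :=
  (\big[minn/#|T|]_(k < #|T|.+1 | g_colorable E k) k)%N.

Definition g_chif (R : realType) (T : finType) (E : rel T) : R :=
  inf [set (\sum_(I : {set T} | g_indep E I) w I) |
        w in [set w : {set T} -> R |
               (forall I, 0 <= w I) /\
               (forall v : T, 1 <= \sum_(I : {set T} | g_indep E I && (v \in I)) w I)]].

Definition g_psd (R : realType) (T : finType) (B : T -> T -> R) : Prop :=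
  (forall i j, B i j = B j i) /\
  (forall x : T -> R, 0 <= \sum_i \sum_j x i * B i j * x j).

Definition lovasz_theta (R : realType) (T : finType) (E : rel T) : R :=
  sup [set (\sum_i \sum_j B i j) |
        B in [set B : T -> T -> R |
               [/\ g_psd B, \sum_i B i i = 1 & forall i j, E i j -> B i j = 0]]].

Definition g_form (F : fieldType) (m : nat) (Om : 'M[F]_m) (x y : 'rV[F]_m) : F :=
  (x *m Om *m y^T) 0 0.

Definition g_alternating (F : fieldType) (m : nat) (Om : 'M[F]_m) : Prop :=
  forall x, g_form Om x x = 0.

Definition g_nondegenerate (F : fieldType) (m : nat) (Om : 'M[F]_m) : Prop :=
  forall x, (forall y, g_form Om x y = 0) -> x = 0.

(* one-dimensional subspaces of F^m, represented by their canonical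
   row-space matrices <<v>> for v <> 0 *)
Definition g_is_point (F : finFieldType) (m : nat) (U : 'M[F]_m) : bool :=
  [exists v : 'rV[F]_m, (v != 0) && (U == <<v>>%MS)].

Definition g_projpoint (F : finFieldType) (m : nat) := {U : 'M[F]_m | g_is_point U}.

Definition sp_adj (F : finFieldType) (m : nat) (Om : 'M[F]_m) : rel (g_projpoint F m) :=
  fun U W => (U != W) &&
    [exists x : 'rV[F]_m, exists y : 'rV[F]_m,
       [&& x != 0, y != 0, val U == <<x>>%MS, val W == <<y>>%MS & g_form Om x y == 0]].

(* Main.v *)
Require Import Defs.
From HB Require Import structures.
From mathcomp Require Import all_boot all_order all_algebra all_field.
From mathcomp Require Import all_classical all_reals all_analysis.
From mathcomp Require Import ring.
Set Implicit Arguments. Unset Strict Implicit. Unset Printing Implicit Defensive.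
Import Order.TTheory GRing.Theory Num.Theory passmx.
Local Open Scope ring_scope.

(* Write m = (q^n - 1)/(q - 1), s = q^(n-1), and let A be the adjacency matrix
   of the complement of G.  Counting vectors off one or two hyperplanes shows
   that A has eigenvalue q s^2 on constants and eigenvalues s, -s elsewhere, so
   D = m I + (m/s) A is J plus a positive semidefinite matrix.  Writing D as a
   Gram matrix gives vectors of squared norm m, orthogonal at the edges of G and
   having inner product 1 with a common unit vector; Bessel's inequality for them
   and their tensor powers bounds theta, alpha and Theta of the complement by m.
   A normalised copy of D is feasible for theta(G), with value N/m = q^n + 1,
   where N = m (q^n + 1) is the number of points.  For the other direction
   identify (F_q^(2n), omega) with L^2, L the field with q^n elements, under the
   form phi(x y' - x' y): colouring (x, y) by its slope y/x is a symplectic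
   spread, i.e. a partition of the points into q^n + 1 cliques of G.  It bounds
   chi of the complement and theta(G) by q^n + 1, and by pigeonhole produces
   a clique of size m. *)

(** * Symplectic spreads *)

(* L is a splitting field of X^(q^n) - X: the roots form the fixed field of the
   n-th power of Frobenius, hence all of L. *)
Lemma finField_extension (F : finFieldType) (n : nat) : (0 < n)%N ->
  exists L : fieldExtType F, \dim {:L} = n.
Proof.
move=> n_gt0; have q_gt1 : (1 < #|F|)%N by exact: finNzRing_gt1.
pose m := (#|F| ^ n)%N.
have m_gt1 : (1 < m)%N by rewrite -(expn0 #|F|) ltn_exp2l.
have m1_gt0 : (0 < m.-1)%N by rewrite -ltnS prednK // ltnW.
pose r (K : nzRingType) : {poly K} := 'X^m - 'X.
(* With the factor X split off, separability reduces to that of X^(m-1) - 1 and to 0 not being a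
   root of it. *)
have Dr (K : nzRingType) : r K = ('X^(m.-1) - 1) * ('X - 0).
  by rewrite /r subr0 mulrBl mul1r -exprSr prednK // ltnW.
have r_neq0 : r F != 0 by rewrite Dr monic_neq0 ?rpredM ?monicXsubC ?monicXnsubC.
have [L] := FinSplittingFieldFor r_neq0.
rewrite rmorphB rmorphXn /= map_polyX -/(r L) => -[zs DrL defL].
(* Translation by 1 permutes F, so the sum of all elements equals itself plus q; hence q = 0 in F,
   and m, a power of q, is 0 in L. *)
have mL : m%:R = 0 :> L.
  have q0 : #|F|%:R = 0 :> F.
    apply: (addrI (\sum_(x : F) x)); rewrite addr0 -[#|F|%:R]sumr_const.
    by rewrite -big_split [RHS](reindex_inj (addIr (1 : F))).
  by rewrite natrX -(rmorph_nat (in_alg L)) q0 rmorph0 expr0n gtn_eqF.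
have Uzs : uniq zs.
  rewrite -separable_prod_XsubC -(eqp_separable DrL) Dr separable_root andbC.
  rewrite /root !hornerE subr_eq0 eq_sym expr0n gtn_eqF ?oner_eq0 //=.
  rewrite cyclotomic.separable_Xn_sub_1 // -subn1 natrB ?(ltnW m_gt1) // mL.
  by rewrite sub0r oppr_eq0 oner_eq0.
have szs : size zs = m.
  apply: succn_inj; rewrite -(size_prod_XsubC _ id) -(eqp_size DrL).
  by rewrite size_polyDl size_polyXn // size_polyN size_polyX.
(* [a] generates the Galois group of L over F and acts as x -> x^q, so [a ^+ n] is x -> x^m. *)
have /finField_galois_generator[/= a _ Da] : (1 <= {:L})%VS by apply: sub1v.
pose E := fixedSpace (a ^+ n)%g.
have in_zs : zs =i E.
  move=> z; rewrite -root_prod_XsubC -(eqp_root DrL) (sameP fixedSpaceP eqP).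
  rewrite /root !hornerE subr_eq0 /= /m; congr (_ == z).
  elim: (n) => [|i IHi]; first by rewrite gal_id.
  by rewrite expgSr expnSr exprM IHi galM ?Da ?memvf // dimv1 expn1.
have defE : E = {:L}%VS.
  apply/eqP; rewrite eqEsubv subvf -defL -[E]subfield_closed agenvS //.
  by rewrite subv_add sub1v; apply/span_subvP=> z; rewrite in_zs.
pose coords := rVof (vbasis {:L}).
have coords_inj : injective coords by apply/can_inj/rVofK/vbasisP.
(* The q^n roots exhaust L, which has q^(dim L) elements by coordinates; compare exponents. *)
exists L; apply/eqP; rewrite -(eqn_exp2l _ _ q_gt1) -/m -szs.
rewrite -[X in (_ ^ X)%N]mul1n -card_mx -(size_map coords).
rewrite -(card_uniqP _) ?(map_inj_uniq coords_inj) //.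
apply/eqP/esym/eq_card => x; rewrite inE -[x](vecofK (vbasisP _)).
by rewrite (mem_map coords_inj) in_zs defE memvf.
Qed.

Section Form.
Context (F : fieldType) (m : nat) (Om : 'M[F]_m).
Implicit Types x y z : 'rV[F]_m.

Lemma g_formDl x y z : g_form Om (x + y) z = g_form Om x z + g_form Om y z.
Proof. by rewrite /g_form !mulmxDl mxE. Qed.

Lemma g_formDr x y z : g_form Om z (x + y) = g_form Om z x + g_form Om z y.
Proof. by rewrite /g_form linearD mulmxDr mxE. Qed.

Lemma g_formZl a x y : g_form Om (a *: x) y = a * g_form Om x y.
Proof. by rewrite /g_form -!scalemxAl mxE. Qed.

Lemma g_formZr a x y : g_form Om x (a *: y) = a * g_form Om x y.
Proof. by rewrite /g_form linearZ -scalemxAr mxE. Qed.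

Lemma g_form_delta i j : g_form Om (delta_mx 0 i) (delta_mx 0 j) = Om i j.
Proof. by rewrite /g_form trmx_delta -colE -rowE !mxE. Qed.

Lemma alternating_skew x y : g_alternating Om -> g_form Om x y = - g_form Om y x.
Proof.
move=> altOm; apply/eqP; rewrite -addr_eq0; apply/eqP.
by have := altOm (x + y); rewrite g_formDl !g_formDr !altOm add0r addr0.
Qed.

End Form.

(* [e] and [e'] send the standard basis to dual bases of L for the form phi(xy). *)
Lemma field_pairing (F : fieldType) (L : fieldExtType F) :
  exists (e e' : {linear 'rV[F]_(\dim {:L}) -> L}) (phi : L -> F),
    forall a b, phi (e a * e' b) = (a *m b^T) 0 0.
Proof.
set n := \dim {:L}; pose b := vbasis {:L}.
have i0 : 'I_n := Ordinal (adim_gt0 _).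
pose phi : {scalar L} := coord b i0.
pose S := \matrix_(i < n, j < n) phi (b`_i * b`_j).
have phiS r r' : phi (vecof b r * vecof b r') = (r *m S *m r'^T) 0 0.
  rewrite /vecof mulr_sumr linear_sum mxE; apply: eq_bigr => j _.
  rewrite mulr_suml linear_sum !mxE mulr_suml; apply: eq_bigr => i _.
  rewrite -scalerAl -scalerAr !linearZ mxE; rewrite /GRing.scale /=; ring.
have S_unit : S \in unitmx.
  rewrite -row_free_unit -kermx_eq0; apply/rowV0P => r /sub_kermxP rS0.
  apply/eqP; rewrite -(vecof_eq0 (vbasisP _)); apply: contraT => r_neq0.
  (* A nonzero kernel vector [r] would make phi vanish on all multiples of a nonzero field element,
     hence on L, although phi is 1 on its own basis vector. *)
  have phi0 x : phi x = 0.
    rewrite -[x](mulfVK r_neq0) mulrC -[x / _](rVofK (vbasisP _)) phiS rS0.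
    by rewrite mul0mx mxE.
  have := phi0 (b`_i0); rewrite /phi /= (coord_free _ _ (basis_free (vbasisP _))) eqxx.
  by move/eqP; rewrite oner_eq0.
exists (vecof b), (vecof b \o mulmxr (invmx S)^T), phi => r r' /=.
by rewrite phiS trmx_mul trmxK mulmxA mulmxK.
Qed.

(** Normal form as a sum of n hyperbolic planes. The induction measures the form by its nonzero
    rows, so the size of the matrix stays fixed; each plane split off removes at least two of
    them. *)
Lemma alternating_decomposition (F : fieldType) (m n : nat) (Om : 'M[F]_m) :
  g_alternating Om -> (#|[set i | row i Om != 0%R]| <= 2 * n)%N ->
  exists A B : 'M[F]_(n, m), Om = A^T *m B - B^T *m A.
Proof.
elim: n Om => [|n IHn] Om altOm; last first.
  case: (pickP [pred ij | Om ij.1 ij.2 != 0]) => [[i j]/= c_neq0 | Om0] leOm; last first.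
    exists 0, 0; rewrite trmx0 mul0mx subrr; apply/matrixP => i j.
    by rewrite mxE; apply/eqP/negbFE; apply: (Om0 (i, j)).
  have skew k l : Om k l = - Om l k.
    by rewrite -!g_form_delta alternating_skew.
  have Om_ii k : Om k k = 0 by rewrite -g_form_delta altOm.
  (* Splitting off the hyperbolic plane of rows i and j clears both rows and
     leaves the zero rows zero. *)
  pose ri := (Om i j)^-1 *: row i Om; pose rj := row j Om.
  pose Om' := Om - (ri^T *m rj - rj^T *m ri).
  have Om'E k l : Om' k l =
      Om k l - ((Om i j)^-1 * Om i k * Om j l - Om j k * ((Om i j)^-1 * Om i l)).
    by rewrite !mxE !big_ord1 !mxE.
  have alt' : g_alternating Om'.
    move=> x; rewrite /g_form mulmxBr mulmxBl mulmxBr mulmxBl !mulmxA.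
    rewrite -![x *m _ *m _ *m _]mulmxA.
    have trE y : y *m x^T = (x *m y^T)^T by rewrite trmx_mul trmxK.
    have swap11 (P Q : 'M[F]_1) : P *m Q^T = Q *m P^T.
      by apply/matrixP => k l; rewrite !mxE !big_ord1 !mxE !ord1 mulrC.
    by rewrite (trE _ ri) (trE _ rj) swap11 subrr subr0; exact: altOm.
  have row' k : (k == i) || (k == j) || (row k Om == 0) -> row k Om' = 0.
    move=> Hk; apply/rowP => l; rewrite [LHS]mxE Om'E [RHS]mxE.
    case/orP: Hk => [/orP[]|] /eqP Hk.
    - by rewrite Hk Om_ii (skew j i); field.
    - by rewrite Hk Om_ii; field.
    - have Ok l' : Om k l' = 0 by move/rowP/(_ l'): Hk; rewrite !mxE.
      by rewrite Ok (skew i k) (skew j k) !Ok; ring.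
  have [|A [B defOm']] := IHn Om' alt'.
    pose S := [set k | row k Om != 0].
    have sub : [set k | row k Om' != 0] \subset S :\ i :\ j.
      apply/fintype.subsetP => k; rewrite !inE; apply: contraR => Hk; apply/eqP/row'.
      by move: Hk; rewrite !negb_and !negbK orbA [(k == j) || _]orbC.
    rewrite (leq_trans (subset_leq_card sub)) //.
    have jDi : j != i by apply: contraNneq c_neq0 => ->; rewrite Om_ii.
    have rowN k l : Om k l != 0 -> row k Om != 0.
      by apply: contraNneq => /rowP/(_ l); rewrite !mxE => ->.
    have Ri : row i Om != 0 by exact: rowN c_neq0.
    have Rj : row j Om != 0 by apply: (rowN j i); rewrite skew oppr_eq0.
    move: leOm; rewrite (cardsD1 i S) (cardsD1 j (S :\ i)) !inE jDi Ri Rj /=.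
    by rewrite mulnS addnA => leOm; rewrite -(leq_add2l 2).
  have defOm : Om = (col_mx ri A)^T *m col_mx rj B - (col_mx rj B)^T *m col_mx ri A.
    rewrite !tr_col_mx !mul_row_col opprD addrACA -defOm'.
    by rewrite /Om' addrC subrK.
  by exists (col_mx ri A), (col_mx rj B).
rewrite muln0 leqn0 cards_eq0 => /eqP Om0; exists 0, 0.
rewrite trmx0 mul0mx subrr; apply/row_matrixP => i; rewrite row0.
by apply/eqP; move/setP/(_ i): Om0; rewrite !inE => /negbFE.
Qed.

(** The colour of v is its slope in L, written in n coordinates, with [None] for the infinite slope.
    For equal slopes the products x y' and x' y coincide, and the form vanishes. *)
Lemma symplectic_spread (F : finFieldType) (n : nat) (Om : 'M[F]_(2 * n)) :
  (0 < n)%N -> g_alternating Om ->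
  exists c : 'rV[F]_(2 * n) -> option 'rV[F]_n,
    forall u v, c u = c v -> g_form Om u v = 0.
Proof.
move=> n_gt0 altOm.
have [|A [B defOm]] := @alternating_decomposition F (2 * n) n Om altOm.
  by rewrite -[leqRHS]card_ord max_card.
have [L dimL] := finField_extension F n_gt0.
have [e [e' [phi ephi]]] := field_pairing L; move: e e' ephi; rewrite dimL => e e' ephi.
have tr00 (M : 'M[F]_1) : M 0 0 = M^T 0 0 by rewrite mxE.
have formE u v : g_form Om u v =
    phi (e (u *m A^T) * e' (v *m B^T)) - phi (e (v *m A^T) * e' (u *m B^T)).
  rewrite !ephi /g_form defOm mulmxBr mulmxBl mxE [X in _ + X]mxE.
  rewrite !trmx_mul !trmxK !mulmxA; congr (_ - _).
  by rewrite tr00 !trmx_mul !trmxK !mulmxA.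
pose b := vbasis {:L}.
pose c v := if e (v *m A^T) == 0 then None
            else Some (rVof b (e' (v *m B^T) / e (v *m A^T))).
(* [f] only transports coordinates along the equality of \dim L and n. *)
have [f f_inj] : exists f : 'rV[F]_(\dim {:L}) -> 'rV[F]_n, injective f by rewrite dimL; exists id.
exists (fun v => omap f (c v)) => u v.
rewrite formE /c; case: eqVneq => [-> | xu]; case: eqVneq => [-> | xv] //=.
  by rewrite !mul0r subrr.
case=> /f_inj /(can_inj (rVofK (vbasisP _))) Euv.
apply/eqP; rewrite subr_eq0; apply/eqP; congr phi.
by rewrite -[e' (v *m _)](mulfVK xv) -Euv -[X in _ = _ * X](mulfVK xu); ring.
Qed.

(** * Orthonormal representations and the theta function *)

Section Handle.
Context (R : realType) (T O : finType).
Implicit Types (E : rel T) (w : O -> R) (u : T -> O -> R) (m : R).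

(* A Lovasz orthonormal representation with handle the basis vector [o0], rescaled
   so that the handle has inner product 1 with every vector; the weights [w] of the
   inner product avoid square roots. *)
Definition orthogonal_rep E w u o0 m : Prop :=
  [/\ forall o, 0 <= w o, w o0 = 1, forall x, u x o0 = 1,
      forall x, \sum_o w o * u x o * u x o = m
    & forall x y, x != y -> ~~ E x y -> \sum_o w o * u x o * u y o = 0].

(** Pairing a Gram matrix with [B] gives a weighted sum of values of the quadratic form of [B]. A
    rank-one [B] yields [gram_psd], a positive semidefinite one the bound on theta. *)
Lemma quadratic_gram w u (B : T -> T -> R) :
  \sum_x \sum_y (\sum_o w o * u x o * u y o) * B x y =
  \sum_o w o * \sum_x \sum_y u x o * B x y * u y o.
Proof.
under eq_bigr do under eq_bigr do rewrite mulr_suml.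
under eq_bigr do rewrite exchange_big.
rewrite exchange_big; apply: eq_bigr => o _; rewrite mulr_sumr.
apply: eq_bigr => x _; rewrite mulr_sumr; apply: eq_bigr => y _; ring.
Qed.

Lemma gram_psd w u : (forall o, 0 <= w o) ->
  g_psd (fun x y => \sum_o w o * u x o * u y o).
Proof.
move=> w_ge0; split=> [x y|z]; first by apply: eq_bigr => o _; ring.
have -> : \sum_i \sum_j z i * (\sum_o w o * u i o * u j o) * z j =
          \sum_o w o * (\sum_i z i * u i o) ^+ 2.
  under eq_bigr do under eq_bigr do rewrite mulrAC mulrC.
  rewrite (quadratic_gram w u (fun i j => z i * z j)); apply: eq_bigr => o _.
  congr (_ * _); rewrite expr2 mulr_suml; apply: eq_bigr => i _.
  by rewrite mulr_sumr; apply: eq_bigr => j _; ring.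
by apply: sumr_ge0 => o _; rewrite mulr_ge0 ?sqr_ge0.
Qed.

(** Pair [B] with the Gram matrix of [u]. Off the diagonal one of the two entries is 0, so the
    result is m times the trace. Coordinate [o0] contributes the sum of [B], and the others are
    nonnegative. *)
Lemma theta_feasible_le E w u o0 m (B : T -> T -> R) :
  orthogonal_rep E w u o0 m ->
  g_psd B -> \sum_i B i i = 1 -> (forall i j, E i j -> B i j = 0) ->
  \sum_i \sum_j B i j <= m.
Proof.
move=> [w_ge0 w1 u1 norm_u orth_u] [_ B_ge0] trB B0.
have <- : \sum_x \sum_y (\sum_o w o * u x o * u y o) * B x y = m.
  rewrite -[RHS]mulr1 -trB mulr_sumr; apply: eq_bigr => x _.
  rewrite (bigD1 x) //= norm_u big1 ?addr0 // => y yDx.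
  case: (boolP (E x y)) => [/B0->|Exy]; first by rewrite mulr0.
  by rewrite orth_u ?mul0r // eq_sym.
rewrite quadratic_gram (bigD1 o0) //= w1 mul1r.
have -> : \sum_i \sum_j u i o0 * B i j * u j o0 = \sum_i \sum_j B i j.
  by apply: eq_bigr => i _; apply: eq_bigr => j _; rewrite !u1 mul1r mulr1.
by rewrite lerDl sumr_ge0 // => o _; rewrite mulr_ge0.
Qed.

(* Bessel's inequality for the tensor powers of the vectors [u x] and of the
   handle [o0]. *)
Lemma alpha_strong_pow_le E w u o0 m k :
  0 <= m -> orthogonal_rep E w u o0 m -> (g_alpha (strong_pow E k))%:R <= m ^+ k.
Proof.
move=> m_ge0 [w_ge0 w1 u1 norm_u orth_u].
suff indep_le (S : {set {ffun 'I_k -> T}}) :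
    g_indep (strong_pow E k) S -> #|S|%:R <= m ^+ k.
  rewrite /g_alpha; elim/big_ind: _ => [|a b|]; last exact: indep_le.
  - exact: exprn_ge0.
  - by rewrite /maxn; case: ifP.
move=> /forall_inP indS.
pose W (o : {ffun 'I_k -> O}) := \prod_i w (o i).
pose U (x : {ffun 'I_k -> T}) (o : {ffun 'I_k -> O}) := \prod_i u (x i) (o i).
have gramU x y : \sum_o W o * U x o * U y o = \prod_i \sum_o w o * u (x i) o * u (y i) o.
  by rewrite bigA_distr_bigA; apply: eq_bigr => o _; rewrite -!big_split.
have sumS : \sum_o W o * (\sum_(x in S) U x o) ^+ 2 = m ^+ k *+ #|S|.
  transitivity (\sum_(x in S) \sum_(y in S) \sum_o W o * U x o * U y o).
    under eq_bigr do rewrite expr2 mulr_suml mulr_sumr.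
    rewrite exchange_big; apply: eq_bigr => x xS.
    under eq_bigr do rewrite !mulr_sumr.
    by rewrite exchange_big; apply: eq_bigr => y yS; apply: eq_bigr => o _; ring.
  rewrite -sumr_const; apply: eq_bigr => x xS.
  rewrite (bigD1 x) //= gramU [X in X + _](eq_bigr (fun=> m)) => [|i _]; last exact: norm_u.
  rewrite prodr_const card_ord big1 ?addr0 // => y /andP[yS yDx].
  have /forall_inP/(_ y yS) := indS x xS.
  (* Independence supplies a coordinate in which x and y are distinct and nonadjacent; that factor
     of the product is 0. *)
  rewrite negb_and eq_sym yDx /= => /forallPn[i]; rewrite negb_or => /andP[xy nE].
  by rewrite gramU (bigD1 i) //= orth_u ?mul0r.
case: (posnP #|S|) => [->|S_gt0]; first exact: exprn_ge0.
rewrite -(ler_pM2r (_ : 0 < #|S|%:R)) ?ltr0n // [leRHS]mulr_natr -sumS.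
(* The constant family [o0] is the tensor power of the handle; its term is #|S|^2, to be compared
   with m^k #|S|. *)
rewrite (bigD1 [ffun=> o0]) //= [W _]big1 => [|i _]; last by rewrite ffunE.
rewrite mul1r (eq_bigr (fun=> 1)) => [|x xS]; last first.
  by rewrite [U _ _]big1 => // i _; rewrite ffunE.
rewrite sumr_const -expr2 lerDl sumr_ge0 // => o _.
by rewrite mulr_ge0 ?sqr_ge0 // prodr_ge0.
Qed.

(** Weak duality with equality: a feasible [B] attains the bound given by the representation. *)
Lemma lovasz_theta_eq E w u o0 m (B : T -> T -> R) :
  orthogonal_rep E w u o0 m ->
  g_psd B -> \sum_i B i i = 1 -> (forall i j, E i j -> B i j = 0) ->
  \sum_i \sum_j B i j = m -> lovasz_theta R E = m.
Proof.
move=> repE psdB trB B0 sumB; apply/eqP; rewrite eq_le; apply/andP; split.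
  apply: ge_sup; first by exists m, B.
  by move=> _ [B' [psdB' trB' B0'] <-]; exact: theta_feasible_le repE _ _ _.
apply: ub_le_sup; last by exists B.
by exists m => _ [B' [psdB' trB' B0'] <-]; exact: theta_feasible_le repE _ _ _.
Qed.

End Handle.

(** * Colourings *)

Lemma card_indep_le_alpha (T : finType) (E : rel T) (S : {set T}) :
  g_indep E S -> (#|S| <= g_alpha E)%N.
Proof. by move=> indS; exact: (@leq_bigmax_cond _ _ (fun S : {set T} => #|S|)). Qed.

Lemma g_alpha_attained (T : finType) (E : rel T) :
  exists2 S : {set T}, g_indep E S & #|S| = g_alpha E.
Proof.
have [|S indS maxS] := @eq_bigmax_cond _ (g_indep E) (fun S : {set T} => #|S|).
  by apply/card_gt0P; exists finset.set0; apply/forall_inP => x; rewrite inE.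
by exists S; last exact: esym maxS.
Qed.

Section Colouring.
Context (R : realType) (T : finType).
Implicit Types (E : rel T) (k : nat).

(** Vertices of the first strong power are functions on a one-point set; the bound is used for the
    term k = 1 of the supremum defining Theta. *)
Lemma le_alpha_strong_pow1 E : (g_alpha E <= g_alpha (strong_pow E 1))%N.
Proof.
apply/bigmax_leqP => S /forall_inP indS.
pose const1 (x : T) : {ffun 'I_1 -> T} := [ffun=> x].
have const1_inj : injective const1 by move=> x y /ffunP/(_ ord0); rewrite !ffunE.
rewrite -(card_imset _ const1_inj); apply: card_indep_le_alpha.
apply/forall_inP => _ /imsetP[x xS ->]; apply/forall_inP => _ /imsetP[y yS ->].
have /forall_inP/(_ y yS) nE := indS x xS.
rewrite negb_and negbK; case: eqVneq => //= xDy.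
apply/forallPn; exists ord0; rewrite !ffunE negb_or nE andbT.
by apply: contraNneq xDy => ->.
Qed.

Lemma g_Theta_eq (O : finType) E (w : O -> R) (u : T -> O -> R) o0 m :
  0 <= m -> orthogonal_rep E w u o0 m -> (g_alpha E)%:R = m -> g_Theta R E = m.
Proof.
move=> m_ge0 repE alphaE; rewrite /g_Theta; set A := (X in sup X).
have A_ub : ubound A m.
  move=> _ [k k_gt0 ->]; apply: le_trans (_ : (m ^+ k) `^ k%:R^-1 <= m).
    apply: ge0_ler_powR; rewrite ?nnegrE ?invr_ge0 ?exprn_ge0 ?ler0n //.
    exact: alpha_strong_pow_le repE.
  by rewrite -powR_mulrn // -powRrM mulfV ?powRr1 // pnatr_eq0 -lt0n.
have A1 : A (g_alpha (strong_pow E 1))%:R.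
  by exists 1%N => //; rewrite invr1 powRr1.
apply/eqP; rewrite eq_le; apply/andP; split.
  by apply: ge_sup => //; exists (g_alpha (strong_pow E 1))%:R.
apply: le_trans (_ : (g_alpha (strong_pow E 1))%:R <= _).
  by rewrite -alphaE ler_nat le_alpha_strong_pow1.
by apply: ub_le_sup => //; exists m.
Qed.

Lemma colorableP E k : reflect (exists f : T -> 'I_k, forall x y, E x y -> f x != f y)
  (g_colorable E k).
Proof.
apply: (iffP existsP) => -[f fE].
  by exists f => x y; apply/implyP; move/forallP/(_ x)/forallP/(_ y): fE.
exists [ffun x => f x]; apply/forallP => x; apply/forallP => y.
by apply/implyP; rewrite !ffunE; exact: fE.
Qed.

Lemma colour_class_indep E k (f : T -> 'I_k) c :
  (forall x y, E x y -> f x != f y) -> g_indep E [set x | f x == c].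
Proof.
move=> fE; apply/forall_inP => x; rewrite inE => /eqP fx.
apply/forall_inP => y; rewrite inE => /eqP fy.
by apply/negP => /fE; rewrite fx fy eqxx.
Qed.

(** Pigeonhole on the colour classes, used both ways: to bound the number of colours given alpha,
    and alpha given a colouring. *)
Lemma card_le_colorable E k : g_colorable E k -> (#|T| <= k * g_alpha E)%N.
Proof.
case/colorableP => f fE; rewrite -sum1_card (partition_big f xpredT) //=.
rewrite -[X in (X * _)%N]card_ord -sum_nat_const; apply: leq_sum => c _.
rewrite sum1_card; apply: leq_trans (card_indep_le_alpha (colour_class_indep c fE)).
by rewrite cardsE.
Qed.

(** Weighted double count of the pairs (v, I) with v in I. *)
Lemma card_le_fractional E (w : {set T} -> R) : (forall I, 0 <= w I) ->
  (forall v : T, 1 <= \sum_(I : {set T} | g_indep E I && (v \in I)) w I) ->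
  #|T|%:R <= (g_alpha E)%:R * \sum_(I : {set T} | g_indep E I) w I.
Proof.
move=> w_ge0 w_cover; rewrite -sumr_const.
apply: le_trans (ler_sum _ (fun v _ => w_cover v)) _.
under eq_bigr do rewrite big_mkcondr.
rewrite exchange_big mulr_sumr; apply: ler_sum => I indI.
rewrite -big_mkcond sumr_const -[leLHS]mulr_natl ler_wpM2r // ler_nat.
exact: card_indep_le_alpha.
Qed.

Lemma fractional_of_colorable E k : g_colorable E k ->
  exists w : {set T} -> R, [/\ forall I, 0 <= w I,
    forall v : T, 1 <= \sum_(I : {set T} | g_indep E I && (v \in I)) w I
    & \sum_(I : {set T} | g_indep E I) w I = k%:R].
Proof.
case/colorableP => f fE; pose K c := [set x | f x == c].
exists (fun I => \sum_(c < k) (I == K c)%:R); split=> [I|v|].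
- by apply: sumr_ge0 => c _; rewrite ler0n.
- rewrite (bigD1 (K (f v))) /=; last by rewrite colour_class_indep // inE eqxx.
  rewrite (bigD1 (f v)) //= eqxx -addrA lerDl addr_ge0 ?sumr_ge0 // => I _.
  by rewrite sumr_ge0.
- rewrite exchange_big -[X in X%:R]card_ord -sumr_const; apply: eq_bigr => c _.
  rewrite (bigD1 (K c)) ?colour_class_indep //= eqxx big1 ?addr0 // => I /andP[_].
  by move=> /negPf ->.
Qed.

Lemma g_chi_eq E k : (0 < g_alpha E)%N -> g_colorable E k ->
  #|T| = (k * g_alpha E)%N -> g_chi E = k.
Proof.
move=> alpha_gt0 colE cardT.
have k_le j : g_colorable E j -> (k <= j)%N.
  by move=> /card_le_colorable; rewrite cardT leq_pmul2r.
(* This puts k in the range of the minimum and also bounds its default value #|T| from below. *)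
have k_leT : (k <= #|T|)%N by rewrite cardT leq_pmulr.
apply/eqP; rewrite eqn_leq; apply/andP; split.
  pose k' := @Ordinal #|T|.+1 k k_leT.
  rewrite /g_chi; have : k' \in index_enum 'I_#|T|.+1 by rewrite mem_index_enum.
  elim: (index_enum _) => // a s IHs; rewrite inE big_cons.
  case/predU1P => [<-|/IHs {}IHs]; first by rewrite /= colE geq_minl.
  by case: ifP => // _; exact: leq_trans (geq_minr _ _) IHs.
rewrite /g_chi; elim/big_ind: _ => // [a b|[j /= _]]; last exact: k_le.
by rewrite leq_min => -> ->.
Qed.

Lemma g_chif_eq E k : (0 < g_alpha E)%N -> g_colorable E k ->
  #|T| = (k * g_alpha E)%N -> g_chif R E = k%:R.
Proof.
move=> alpha_gt0 colE cardT.
have [w [w_ge0 w_cover sumw]] := fractional_of_colorable colE.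
rewrite /g_chif; set A := (X in inf X).
have A_lb : lbound A k%:R.
  move=> _ [w' [w'_ge0 w'_cover] <-].
  rewrite -(ler_pM2l (_ : 0 < (g_alpha E)%:R)) ?ltr0n // mulrC -natrM -cardT.
  exact: card_le_fractional.
have Ak : A k%:R by exists w.
apply/eqP; rewrite eq_le; apply/andP; split; first by apply: ge_inf => //; exists k%:R.
by apply: lb_le_inf => //; exists k%:R.
Qed.

(** With weight 1/2, the pair coordinates factor k I - J, the Laplacian of the complete graph on the
    colours; the handle adds J. The Gram matrix is thus k times the same-colour relation. *)
Definition colour_rep k (f : T -> 'I_k) (x : T) (o : option ('I_k * 'I_k)) : R :=
  if o is Some (c, d) then (f x == c)%:R - (f x == d)%:R else 1.

Lemma colour_rep_orthogonal E k (f : T -> 'I_k) :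
  (forall x y, g_compl E x y -> f x != f y) ->
  orthogonal_rep E (fun o => if o is Some _ then 2^-1 else 1) (colour_rep f) None k%:R.
Proof.
move=> fE.
have gram x y : \sum_o (if o is Some _ then 2^-1 else 1) * colour_rep f x o * colour_rep f y o
    = k%:R * (f x == f y)%:R :> R.
  have sum1 (c : 'I_k) : \sum_d (c == d)%:R = 1 :> R.
    by rewrite (bigD1 c) //= eqxx big1 ?addr0 // => d /negPf; rewrite eq_sym => ->.
  have sum2 (c c' : 'I_k) : \sum_d (c == d)%:R * (c' == d)%:R = (c == c')%:R :> R.
    rewrite (bigD1 c) //= eqxx mul1r [c' == c]eq_sym big1 ?addr0 // => d /negPf.
    by rewrite eq_sym => ->; rewrite mul0r.
  rewrite (bigD1 None) //= !mulr1.
  rewrite (reindex_omap Some id) => [|[]] //=.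
  under eq_bigl do rewrite eqxx.
  pose F c d := 2^-1 * ((f x == c)%:R - (f x == d)%:R) *
    ((f y == c)%:R - (f y == d)%:R) : R.
  have inner c : \sum_d F c d = 2^-1 * ((f x == c)%:R * (f y == c)%:R * k%:R
       - (f x == c)%:R - (f y == c)%:R + (f x == f y)%:R).
    transitivity (\sum_d (2^-1 * (f x == c)%:R * (f y == c)%:R
        - 2^-1 * (f x == c)%:R * (f y == d)%:R - 2^-1 * (f y == c)%:R * (f x == d)%:R
        + 2^-1 * ((f x == d)%:R * (f y == d)%:R)) : R).
      by apply: eq_bigr => d _; rewrite /F; ring.
    rewrite big_split /= !sumrB -!mulr_sumr sum2 !sum1 sumr_const card_ord -mulr_natl.
    by ring.
  rewrite (eq_bigr (fun p => F p.1 p.2)) => [|[c d] _]; last by [].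
  rewrite -(pair_bigA _ F) /=.
  under eq_bigr do rewrite inner.
  rewrite -mulr_sumr big_split /= !sumrB -mulr_suml sum2 !sum1 sumr_const card_ord -mulr_natl.
  by field.
split=> //= [p|x|x y xDy nE]; first by case: p => // _; rewrite invr_ge0.
  by rewrite gram eqxx mulr1.
by rewrite gram (negPf (fE _ _ _)) ?mulr0 // /g_compl xDy.
Qed.

End Colouring.

(** * The spectral representation *)

(** The witness is the rank-one matrix of the indicator of [S], divided by #|S|; it gives theta >=
    alpha. *)
Lemma indicator_feasible (R : realType) (T : finType) (E : rel T) (S : {set T}) :
  (0 < #|S|)%N -> g_indep E S ->
  exists B : T -> T -> R, [/\ g_psd B, \sum_i B i i = 1,
    forall i j, E i j -> B i j = 0 & \sum_i \sum_j B i j = #|S|%:R].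
Proof.
move=> S_gt0 indS.
have S_neq0 : #|S|%:R != 0 :> R by rewrite pnatr_eq0 -lt0n.
have sumS : \sum_i (i \in S)%:R = #|S|%:R :> R.
  by rewrite -natr_sum -sum1_card [in RHS]big_mkcond.
exists (fun i j => #|S|%:R^-1 * ((i \in S)%:R * (j \in S)%:R)); split.
- split=> [i j|x]; first by rewrite [X in _ * X]mulrC.
  have -> : \sum_i \sum_j x i * (#|S|%:R^-1 * ((i \in S)%:R * (j \in S)%:R)) * x j =
      #|S|%:R^-1 * (\sum_i (x i * (i \in S)%:R)) ^+ 2.
    rewrite expr2 mulr_suml mulr_sumr; apply: eq_bigr => i _.
    by rewrite !mulr_sumr; apply: eq_bigr => j _; ring.
  by rewrite mulr_ge0 ?sqr_ge0 ?invr_ge0.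
- rewrite -mulr_sumr -[RHS](mulVf S_neq0) -sumS; congr (_ * _).
  by apply: eq_bigr => i _; case: (i \in S); rewrite ?mulr1 ?mulr0.
- move=> i j Eij; case: (boolP (i \in S)) => [iS|]; last by rewrite mul0r mulr0.
  have /forall_inP/(_ i iS)/forall_inP/(_ j) := indS.
  by case: (j \in S) => [/(_ isT)|_]; rewrite ?Eij ?mulr0.
- under eq_bigr do rewrite -!mulr_sumr sumS mulrCA mulVf ?mulr1 //.
  exact: sumS.
Qed.

(** Every fibre of [f] is a translate of the one over [w0], so all fibres have the same size. *)
Lemma card_preim_translates (V : finZmodType) (W : finType) (f : V -> W) (w0 : W)
    (A : {set W}) :
  (forall w, exists v0, forall v, (f (v + v0) == w) = (f v == w0)) ->
  (#|[set v | f v \in A]| * #|W| = #|A| * #|V|)%N.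
Proof.
move=> f_trans; pose ker := [set v | f v == w0].
have fiber w : #|[set v | f v == w]| = #|ker|.
  have [v0 fv0] := f_trans w; rewrite -(card_imset ker (addIr v0)); apply: eq_card => v.
  rewrite inE; apply/idP/imsetP => [fv|[u]]; last by rewrite inE -fv0 => fu ->.
  by exists (v - v0); rewrite ?subrK // inE -fv0 subrK.
have cardA (B : {set W}) : #|[set v | f v \in B]| = (#|B| * #|ker|)%N.
  rewrite -sum1_card (partition_big f (mem B)) /= => [|v]; last by rewrite inE.
  rewrite -sum_nat_const; apply: eq_bigr => w wB; rewrite sum1_card -(fiber w).
  apply: eq_card => v; rewrite !inE -topredE /= inE.
  by case: eqP => [->|_]; rewrite ?wB ?andbF.
have <- : (#|W| * #|ker|)%N = #|V|.
  by rewrite -cardsT -cardA -[RHS]cardsT; apply: eq_card => v; rewrite !inE.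
by rewrite cardA -mulnA [(_ * #|W|)%N]mulnC.
Qed.

Section SpectralRep.
Context (R : realType) (T : finType) (a : T -> T -> R) (Q s m : R).
Hypotheses (Q_gt1 : 1 < Q) (s_gt0 : 0 < s) (m_gt0 : 0 < m).
Hypothesis mE : (Q - 1) * m = Q * s - 1.
Hypothesis a_sym : forall x y, a x y = a y x.
Hypothesis a_diag : forall x, a x x = 0.
Hypothesis a_row : forall x, \sum_z a x z = Q * s ^+ 2.
Hypothesis a_sqr : forall x y,
  \sum_z a x z * a y z = s ^+ 2 * (Q - 1) + s ^+ 2 * (x == y)%:R.
Hypothesis cardT : #|T|%:R = m * (Q * s + 1).

Let sum_constT (c : R) : \sum_(z : T) c = m * (Q * s + 1) * c.
Proof. by rewrite sumr_const -cardT mulr_natl. Qed.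

(* [a] has eigenvalues [Q s^2] on constants and [s], [-s] elsewhere, so this is
   [2 s] times the projection onto the [s]-eigenspace. *)
Definition spectral_kernel x z : R := s * (x == z)%:R + a x z - s / m.

Definition spectral_rep x (z : option T) : R :=
  if z is Some z then spectral_kernel x z else 1.

(** The kernel K satisfies K^2 = 2 s K, so this factor turns K^2 into (m/s) K = m I + (m/s) a - J;
    the handle restores J. *)
Definition spectral_weight (z : option T) : R := if z is Some _ then m / (2 * s ^+ 2) else 1.

Lemma spectral_weight_ge0 z : 0 <= spectral_weight z.
Proof. by case: z => //= _; rewrite divr_ge0 ?mulr_ge0 ?sqr_ge0 ?ler0n // ltW. Qed.

Lemma spectral_gram x y :
  \sum_z spectral_weight z * spectral_rep x z * spectral_rep y z =
  m * (x == y)%:R + m / s * a x y.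
Proof.
have s_neq0 := lt0r_neq0 s_gt0; have m_neq0 := lt0r_neq0 m_gt0.
have delta1 (x' : T) (g : T -> R) : \sum_z (x' == z)%:R * g z = g x'.
  rewrite (bigD1 x') //= eqxx mul1r big1 ?addr0 // => z /negPf.
  by rewrite eq_sym => ->; rewrite mul0r.
have delta0 (x' : T) : \sum_z (x' == z)%:R = 1 :> R.
  by rewrite -[RHS](delta1 x' (fun=> 1)); apply: eq_bigr => z _; rewrite mulr1.
have sqr : \sum_z spectral_kernel x z * spectral_kernel y z =
    2 * s * spectral_kernel x y.
  transitivity (\sum_z (s ^+ 2 * ((x == z)%:R * (y == z)%:R) + s * ((x == z)%:R * a y z)
      + s * ((y == z)%:R * a x z) + a x z * a y z - s ^+ 2 / m * (x == z)%:R
      - s ^+ 2 / m * (y == z)%:R - s / m * a x z - s / m * a y z + (s / m) ^+ 2)).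
    by apply: eq_bigr => z _; rewrite /spectral_kernel; field.
  rewrite !(big_split, sumrB) /= !sumrN -!mulr_sumr !delta1 !delta0 !a_row a_sqr.
  rewrite (a_sym y x) sum_constT /spectral_kernel (eq_sym y x).
  apply/eqP; rewrite -subr_eq0.
  (* Only a multiple of the all-ones matrix survives; its coefficient vanishes by [mE]. *)
  rewrite [X in X == 0](_ : _ = s ^+ 2 * (Q - 1 - (Q * s - 1) / m)).
    by rewrite -mE mulfK // subrr mulr0.
  by field.
rewrite (bigD1 None) //= !mulr1 (reindex_omap Some id) => [|[]] //=.
under eq_bigl do rewrite eqxx.
under eq_bigr do rewrite -mulrA.
by rewrite -mulr_sumr sqr /spectral_kernel; field; rewrite s_neq0 m_neq0.
Qed.

Lemma spectral_orthogonal (E : rel T) :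
  (forall x y, x != y -> ~~ E x y -> a x y = 0) ->
  orthogonal_rep E spectral_weight spectral_rep None m.
Proof.
move=> aE; split=> // [|x|x y xDy nE].
- exact: spectral_weight_ge0.
- by rewrite spectral_gram eqxx a_diag mulr0 addr0 mulr1.
- by rewrite spectral_gram aE // (negPf xDy) !mulr0 addr0.
Qed.

Lemma spectral_feasible (E : rel T) :
  (forall x y, E x y -> x != y /\ a x y = 0) ->
  exists B : T -> T -> R, [/\ g_psd B, \sum_i B i i = 1,
    forall i j, E i j -> B i j = 0 & \sum_i \sum_j B i j = Q * s + 1].
Proof.
move=> aE; have s_neq0 := lt0r_neq0 s_gt0; have m_neq0 := lt0r_neq0 m_gt0.
have Qs_neq0 : Q * s + 1 != 0.
  by rewrite lt0r_neq0 // addr_gt0 // mulr_gt0 // (lt_trans ltr01).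
pose N : R := m * (Q * s + 1).
have N_gt0 : 0 < N by rewrite mulr_gt0 // addr_gt0 // mulr_gt0 // (lt_trans ltr01).
have N_neq0 := lt0r_neq0 N_gt0.
(* The unscaled Gram matrix has N diagonal entries equal to m, so this makes the trace 1. *)
pose w z := (N * m)^-1 * spectral_weight z.
have w_ge0 z : 0 <= w z.
  by apply: mulr_ge0 (spectral_weight_ge0 z); rewrite invr_ge0 ltW // mulr_gt0.
have BE x y : \sum_z w z * spectral_rep x z * spectral_rep y z =
    (N * m)^-1 * (m * (x == y)%:R + m / s * a x y).
  by rewrite -spectral_gram mulr_sumr; apply: eq_bigr => z _; rewrite !mulrA.
exists (fun x y => \sum_z w z * spectral_rep x z * spectral_rep y z); split.
- exact: gram_psd.
- under eq_bigr do rewrite BE eqxx a_diag mulr0 addr0 mulr1.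
  rewrite sum_constT -/N; by field; rewrite N_neq0 m_neq0.
- by move=> x y /aE[/negPf xDy a0]; rewrite BE xDy a0 !mulr0 addr0 mulr0.
- have row x : \sum_y (N * m)^-1 * (m * (x == y)%:R + m / s * a x y) = m^-1.
    rewrite -mulr_sumr big_split /= -!mulr_sumr a_row.
    rewrite (bigD1 x) //= eqxx mulr1n big1 ?addr0 => [|z /negPf]; last by rewrite eq_sym => ->.
    by rewrite /N; field; rewrite Qs_neq0 m_neq0 s_neq0.
  under eq_bigr do under eq_bigr do rewrite BE.
  under eq_bigr do rewrite row.
  by rewrite sum_constT; field.
Qed.

End SpectralRep.

(** * Points of the projective space *)

Section Points.
Context (F : finFieldType) (m : nat).
Local Notation V := 'rV[F]_m.
Local Notation T := (g_projpoint F m).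

Lemma projpoint_rep_exists (U : T) : exists v : V, (v != 0) && (val U == <<v>>%MS).
Proof. exact/existsP/(valP U). Qed.

Definition projpoint_rep (U : T) : V := xchoose (projpoint_rep_exists U).

Lemma projpoint_rep_neq0 U : projpoint_rep U != 0.
Proof. by case/andP: (xchooseP (projpoint_rep_exists U)). Qed.

Lemma projpoint_repK U : val U = <<projpoint_rep U>>%MS.
Proof. by case/andP: (xchooseP (projpoint_rep_exists U)) => _ /eqP. Qed.

Lemma genmx_line_eq (x y : V) : x != 0 -> <<x>>%MS = <<y>>%MS ->
  exists2 a, a != 0 & x = a *: y.
Proof.
move=> x_neq0 xy; have /sub_rVP[a xay] : (x <= y)%MS.
  by rewrite -(genmxE y) -xy genmxE.
by exists a => //; apply: contraNneq x_neq0 => a0; rewrite xay a0 scale0r.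
Qed.

Lemma genmx_lineZ a (x : V) : a != 0 -> <<a *: x>>%MS = <<x>>%MS.
Proof. by move=> a_neq0; apply/eq_genmx/eqmx_scale. Qed.

Lemma projpoint_rep_inj U W a : projpoint_rep U = a *: projpoint_rep W -> U = W.
Proof.
move=> UaW; apply: val_inj; rewrite !projpoint_repK UaW genmx_lineZ //.
by have := projpoint_rep_neq0 U; rewrite UaW; apply: contraNneq => ->; rewrite scale0r.
Qed.

Lemma projpoint_of_vector (v : V) : v != 0 -> exists U : T, val U = <<v>>%MS.
Proof.
move=> v_neq0; suff h : g_is_point <<v>>%MS by exists (Sub _ h : T); rewrite SubK.
by apply/existsP; exists v; rewrite v_neq0 eqxx.
Qed.

(** Each point contains q - 1 nonzero vectors, on which [g] is constant; this turns sums over points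
    into counts of vectors. *)
Lemma sum_projpoint_rep (R : pzRingType) (g : V -> R) :
  (forall a v, a != 0 -> g (a *: v) = g v) ->
  (#|F|%:R - 1) * (\sum_(U : T) g (projpoint_rep U)) = \sum_(v | v != 0) g v.
Proof.
move=> gZ; rewrite mulr_sumr.
rewrite (eq_bigr (fun v => \sum_(U : T | val U == <<v>>%MS) g v)) => [|v v_neq0]; last first.
  have [W W_v] := projpoint_of_vector v_neq0.
  by rewrite /= (big_pred1 W) // => U; rewrite -W_v val_eqE.
rewrite (exchange_big_dep xpredT) //=; apply: eq_bigr => U _.
rewrite (eq_bigr (fun=> g (projpoint_rep U))) => [|v /andP[v_neq0 /eqP]]; last first.
  by rewrite projpoint_repK => /esym/(genmx_line_eq v_neq0)[a a_neq0 ->]; exact: gZ.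
have scal_inj : injective (fun a : F => a *: projpoint_rep U).
  by move=> a b /eqP; rewrite -subr_eq0 -scalerBl scaler_eq0
    (negPf (projpoint_rep_neq0 U)) orbF subr_eq0 => /eqP.
rewrite sumr_const -[RHS]mulr_natl; congr (_ * _).
rewrite (_ : #|_| = #|[set~ (0 : F)]|); last first.
  rewrite -(card_imset _ scal_inj); apply: eq_card => v; rewrite unfold_in.
  apply/andP/imsetP => [[v_neq0 /eqP]|[a]].
    rewrite projpoint_repK => /esym/(genmx_line_eq v_neq0)[a a_neq0 ->].
    by exists a => //; rewrite !inE.
  rewrite !inE => a_neq0 ->; rewrite scaler_eq0 negb_or a_neq0 projpoint_rep_neq0.
  by rewrite genmx_lineZ // projpoint_repK.
by rewrite cardsC1 -subn1 natrB // (leq_trans _ (finNzRing_gt1 F)).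
Qed.

Lemma card_projpoint (R : pzRingType) :
  (#|F|%:R - 1) * #|{: T}|%:R = #|F|%:R ^+ m - 1 :> R.
Proof.
rewrite -[X in _ * X]sumr_const [LHS](sum_projpoint_rep (g := fun=> 1)) //.
rewrite sumr_const (_ : #|_| = (#|F| ^ m).-1); last first.
  by rewrite -[m in (_ ^ m)%N]mul1n -card_mx -(cardC1 (0 : V)); apply: eq_card.
have Fm_gt0 : (0 < #|F| ^ m)%N by rewrite expn_gt0 (leq_trans _ (finNzRing_gt1 F)).
by rewrite -subn1 natrB // natrX.
Qed.

(** * Nonorthogonality counts for a symplectic form *)

Context (Om : 'M[F]_m).
Hypotheses (altOm : g_alternating Om) (ndOm : g_nondegenerate Om).

Let form (U W : T) := g_form Om (projpoint_rep U) (projpoint_rep W).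

Lemma sp_adjE U W : sp_adj Om U W = (U != W) && (form U W == 0).
Proof.
rewrite /sp_adj; congr (_ && _); apply/existsP/idP => [[x /existsP[y]]|UW0].
  case/and5P=> x0 y0 /eqP Ux /eqP Wy xy0.
  have := Ux; rewrite projpoint_repK => /(genmx_line_eq (projpoint_rep_neq0 _))[a _ Ua].
  have := Wy; rewrite projpoint_repK => /(genmx_line_eq (projpoint_rep_neq0 _))[b _ Wb].
  by rewrite /form Ua Wb g_formZl g_formZr (eqP xy0) !mulr0.
exists (projpoint_rep U); apply/existsP; exists (projpoint_rep W).
by rewrite !projpoint_rep_neq0 -!projpoint_repK !eqxx.
Qed.

Lemma sp_complE U W : g_compl (sp_adj Om) U W = (form U W != 0).
Proof.
rewrite /g_compl sp_adjE; case: eqVneq => [->|//].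
by rewrite /form altOm eqxx.
Qed.

Lemma g_form_surj (x : V) : x != 0 -> exists v, g_form Om x v = 1.
Proof.
move=> x_neq0.
have [v xv|x0] := pickP (fun v => g_form Om x v != 0); last first.
  case/eqP: x_neq0; apply: ndOm => v; apply/eqP.
  by move: (x0 v) => /negbFE.
by exists ((g_form Om x v)^-1 *: v); rewrite g_formZr mulVf.
Qed.

Lemma g_form_separate (x y : V) : x != 0 -> (forall a, y != a *: x) ->
  exists2 v, g_form Om x v = 0 & g_form Om y v = 1.
Proof.
move=> x_neq0 indep; have [v1 xv1] := g_form_surj x_neq0.
pose t := g_form Om y v1.
(* Making [v] orthogonal to x by subtracting a multiple of [v1] changes its pairing with y to its
   pairing with y - t x, hence this choice. *)
have [v ytv] : exists v, g_form Om (y - t *: x) v = 1.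
  by apply: g_form_surj; rewrite subr_eq0.
exists (v - g_form Om x v *: v1).
  by rewrite -scaleNr g_formDr g_formZr xv1 mulr1 subrr.
rewrite -ytv -!scaleNr g_formDr g_formZr g_formDl g_formZl -/t; ring.
Qed.

Lemma card_nonorth (x : V) : x != 0 ->
  (#|[set v | g_form Om x v != 0%R]| * #|F| = #|F|.-1 * #|V|)%N.
Proof.
move=> x_neq0; rewrite -(cardsC1 (0 : F)) -(card_preim_translates (f := g_form Om x) (w0 := 0)).
- by congr (_ * _)%N; apply: eq_card => v; rewrite !inE.
- move=> a; have [v xv] := g_form_surj x_neq0; exists (a *: v) => u.
  by rewrite g_formDr g_formZr xv mulr1 -subr_eq0 addrK.
Qed.

(** By independence the pair of forms hits every value in F^2 equally often, and (q-1)^2 of these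
    values have no zero entry. *)
Lemma card_nonorth2 (x y : V) : x != 0 -> (forall a, y != a *: x) ->
  (#|[set v | (g_form Om x v != 0%R) && (g_form Om y v != 0%R)]| * #|F| ^ 2
    = #|F|.-1 ^ 2 * #|V|)%N.
Proof.
move=> x_neq0 indep.
have y_neq0 : y != 0 by rewrite -(scale0r x).
have indep' a : x != a *: y.
  apply/eqP => xay; case: (eqVneq a 0) => [a0|a_neq0].
    by move: x_neq0; rewrite xay a0 scale0r eqxx.
  by case/eqP: (indep a^-1); rewrite xay scalerA mulVf ?scale1r.
pose A := finset.setX [set~ (0 : F)] [set~ (0 : F)].
have cardA : #|A| = (#|F|.-1 ^ 2)%N by rewrite cardsX !cardsC1.
rewrite -cardA -[(#|F| ^ 2)%N]card_prod.
rewrite -(card_preim_translates (f := fun v => (g_form Om x v, g_form Om y v)) (w0 := (0, 0))).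
- by congr (_ * _)%N; apply: eq_card => v; rewrite !inE.
- move=> [a b]; have [v xv yv] := g_form_separate x_neq0 indep.
  have [w yw xw] := g_form_separate y_neq0 indep'.
  exists (a *: w + b *: v) => u.
  rewrite !g_formDr !g_formZr xv yv xw yw !mulr1 !mulr0 addr0 add0r !xpair_eqE.
  by rewrite -subr_eq0 addrK -[X in _ && X]subr_eq0 addrK.
Qed.

Context (R : realType).
Local Notation q := (#|F|%:R : R).

Definition nonorth (U W : T) : R := (form U W != 0)%:R.

Let q1_neq0 : q - 1 != 0.
Proof. by rewrite subr_eq0 pnatr_eq1 gtn_eqF ?finNzRing_gt1. Qed.

Lemma natr_card_pred : #|F|.-1%:R = q - 1.
Proof. by rewrite -subn1 natrB // (leq_trans _ (finNzRing_gt1 F)). Qed.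

Lemma sum_nonorth U : (\sum_W nonorth U W) * q = q ^+ m.
Proof.
apply: (mulfI q1_neq0); rewrite mulrA.
rewrite (sum_projpoint_rep (g := fun v => (g_form Om (projpoint_rep U) v != 0)%:R)); last first.
  by move=> a v a_neq0; rewrite g_formZr mulf_eq0 (negPf a_neq0).
rewrite -natr_card_pred -!natrX -!natrM.
have := card_nonorth (projpoint_rep_neq0 U).
rewrite card_mx mul1n => <-; rewrite natrM; congr (_ * _).
rewrite -natr_sum -sum1_card big_mkcond [in RHS]big_mkcond /=; congr (_%:R).
(* The zero vector is excluded on the left and contributes 0 on the right. *)
apply: eq_bigr => v _; rewrite inE; case: eqVneq => [->|_]; last by case: ifP.
by rewrite -(scale0r 0) g_formZr mul0r eqxx.
Qed.

Lemma sum_nonorth2 U W : U != W ->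
  (\sum_Z nonorth U Z * nonorth W Z) * q ^+ 2 = (q - 1) * q ^+ m.
Proof.
move=> UDW; apply: (mulfI q1_neq0); rewrite mulrA.
under eq_bigr do rewrite -natrM mulnb.
rewrite (sum_projpoint_rep (g := fun v => ((g_form Om (projpoint_rep U) v != 0) &&
    (g_form Om (projpoint_rep W) v != 0))%:R)); last first.
  by move=> a v a_neq0; rewrite !g_formZr !mulf_eq0 (negPf a_neq0).
rewrite [RHS]mulrA -expr2 -natr_card_pred -!natrX -!natrM.
have WU a : projpoint_rep W != a *: projpoint_rep U.
  by apply: contraNneq UDW => /projpoint_rep_inj ->.
have := card_nonorth2 (projpoint_rep_neq0 U) WU.
rewrite card_mx mul1n => <-; rewrite natrM; congr (_ * _).
rewrite -natr_sum -sum1_card big_mkcond [in RHS]big_mkcond /=; congr (_%:R).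
apply: eq_bigr => v _; rewrite inE; case: eqVneq => [->|_]; last by case: ifP.
by rewrite -(scale0r 0) g_formZr mul0r eqxx.
Qed.

End Points.

Theorem mainTheorem3 (R : realType) (F : finFieldType) (n : nat)
    (Om : 'M[F]_(2 * n)) :
  (0 < n)%N -> g_alternating Om -> g_nondegenerate Om ->
  let q := #|F| in
  let G := sp_adj Om in
  [/\ (g_alpha (g_compl G))%:R = ((q ^ n)%:R - 1) / (q%:R - 1) :> R,
      g_Theta R (g_compl G) = ((q ^ n)%:R - 1) / (q%:R - 1)
    & lovasz_theta R (g_compl G) = ((q ^ n)%:R - 1) / (q%:R - 1)] /\
  [/\ lovasz_theta R G = (q ^ n + 1)%:R,
      g_chif R (g_compl G) = (q ^ n + 1)%:R
    & g_chi (g_compl G) = (q ^ n + 1)%N].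
Proof.
move=> n_gt0 altOm ndOm q G.
have q_gt1 : (1 < q)%N := finNzRing_gt1 F.
pose Q : R := q%:R; pose s := Q ^+ n.-1; pose m := (Q * s - 1) / (Q - 1).
have Q_gt1 : 1 < Q by rewrite -(ltr_nat R) in q_gt1.
have Q_gt0 : 0 < Q := lt_trans ltr01 Q_gt1.
have s_gt0 : 0 < s by exact: exprn_gt0.
have Q1_neq0 : Q - 1 != 0 by rewrite subr_eq0 gt_eqF.
have Qs : (q ^ n)%:R = Q * s by rewrite natrX -exprS prednK.
have mE : (Q - 1) * m = Q * s - 1 by rewrite mulrC divfK.
have m_gt0 : 0 < m.
  by rewrite divr_gt0 ?subr_gt0 // -exprS prednK // exprn_egt1 // -lt0n.
have Q2n : Q ^+ (2 * n) = (Q * s) ^+ 2 by rewrite mulnC exprM -Qs natrX.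
have cardT : #|{: g_projpoint F (2 * n)}|%:R = m * (Q * s + 1).
  apply: (mulfI Q1_neq0); rewrite mulrA mE card_projpoint -/q -/Q Q2n; ring.
pose a := nonorth Om R.
have a_sym U W : a U W = a W U.
  by rewrite /a /nonorth alternating_skew // oppr_eq0.
have a_diag U : a U U = 0 by rewrite /a /nonorth altOm eqxx.
have a_row U : \sum_W a U W = Q * s ^+ 2.
  apply: (mulIf (lt0r_neq0 Q_gt0)); rewrite sum_nonorth // -/q -/Q Q2n; ring.
have a_sqr U W : \sum_Z a U Z * a W Z = s ^+ 2 * (Q - 1) + s ^+ 2 * (U == W)%:R.
  (* On the diagonal the entries are 0 or 1, so their squares sum to the degree. *)
  case: eqVneq => [->|UDW] /=.
    transitivity (\sum_Z a W Z); last by rewrite a_row /=; ring.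
    by apply: eq_bigr => Z _; rewrite /a /nonorth; case: (_ != _); rewrite ?mulr1 ?mulr0.
  apply: (mulIf (_ : Q ^+ 2 != 0)); first by rewrite expf_neq0 // lt0r_neq0.
  rewrite sum_nonorth2 // -/q -/Q Q2n; ring.
have complE U W : g_compl G U W = (a U W != 0).
  by rewrite sp_complE // /a /nonorth; case: (_ != _); rewrite ?oner_eq0 ?eqxx.
have repGc : orthogonal_rep (g_compl G) (spectral_weight s m) (spectral_rep a s m) None m.
  apply: (spectral_orthogonal (Q := Q)) => // U W UDW; rewrite complE negbK => /eqP //.
have [c c_orth] := symplectic_spread n_gt0 altOm.
have card_col : #|{: option 'rV[F]_n}| = (q ^ n + 1)%N.
  by rewrite card_option card_mx mul1n addn1.
pose f (U : g_projpoint F (2 * n)) : 'I_(q ^ n + 1) :=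
  cast_ord card_col (enum_rank (c (projpoint_rep U))).
have fE U W : g_compl G U W -> f U != f W.
  rewrite sp_complE //; apply: contraNneq => /cast_ord_inj/enum_rank_inj/c_orth ->.
  by rewrite eqxx.
have colGc : g_colorable (g_compl G) (q ^ n + 1) by apply/colorableP; exists f.
(* Bessel for the first strong power gives the upper bound; q^n + 1 colour classes covering m (q^n +
   1) points give the lower one. *)
have alphaGc : (g_alpha (g_compl G))%:R = m :> R.
  apply/eqP; rewrite eq_le; apply/andP; split.
    rewrite -[m]expr1; apply: le_trans (alpha_strong_pow_le 1 (ltW m_gt0) repGc).
    by rewrite ler_nat le_alpha_strong_pow1.
  have := card_le_colorable colGc; rewrite -(ler_nat R) cardT natrM natrD Qs mulrC.
  by rewrite ler_pM2l // addr_gt0 // mulr_gt0.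
have alpha_gt0 : (0 < g_alpha (g_compl G))%N by rewrite -(ltr_nat R) alphaGc.
have cardT' : #|{: g_projpoint F (2 * n)}| = ((q ^ n + 1) * g_alpha (g_compl G))%N.
  by apply/eqP; rewrite -(eqr_nat R) cardT natrM natrD Qs alphaGc mulrC.
rewrite Qs; split; split => //.
- exact: g_Theta_eq (ltW m_gt0) repGc alphaGc.
(* A maximum independent set has m points, so its indicator matrix attains the spectral bound. *)
- have [S indS cardS] := g_alpha_attained (g_compl G).
  have [|B [psdB trB B0 sumB]] := @indicator_feasible R _ _ S _ indS.
    by rewrite cardS.
  by apply: lovasz_theta_eq repGc psdB trB B0 _; rewrite sumB cardS.
- have [|B [psdB trB B0 sumB]] := spectral_feasible Q_gt1 s_gt0 m_gt0
      mE a_sym a_diag a_row a_sqr cardT (E := G).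
    move=> U W; rewrite /G sp_adjE // => /andP[UDW /eqP form0]; split=> //.
    by rewrite /a /nonorth form0 eqxx.
  (* The roles are exchanged for G: the spectral matrix is feasible, and the spread gives the upper
     bound. *)
  apply: lovasz_theta_eq (colour_rep_orthogonal R fE) psdB trB B0 _.
  by rewrite sumB natrD Qs.
- exact: g_chif_eq.
- exact: g_chi_eq.
Qed.
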